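(* Let $\Gamma$ be a sequent and $\varphi$ a $\bigvee$-formula of finite depth. Let $f_0$ be a winning strategy for Eloisa in $G(\Gamma,\neg\varphi)$ and $f_1$ a winning strategy for Eloisa in $G(\Gamma,\varphi)$. Let $p=a_1a_2\cdots$ be a (finite or infinite) sequence of moves in $G(\Gamma)$ and let $d(p)$ be a debate for $p$ (where $d$ is a debate for $f_0,f_1,\Gamma,\varphi$). Then $d_s$ is undefined for some $s$, i.e. $d(p)$ is finite.
   Context: Infinitary formulas. Formulas (negation normal form) over a set of atoms: literals $p,\neg p$; for nonempty $I$, $\bigvee_{i\in I}\varphi_i$ ($\bigvee$-formulas) and $\bigwedge_{i\in I}\varphi_i$ ($\bigwedge$-formulas). Negation via De Morgan duality ($\neg\neg p=p$, $\neg\bigvee\varphi_i=\bigwedge\neg\varphi_i$, $\neg\bigwedge\varphi_i=\bigvee\neg\varphi_i$). A fixed set $S$ of literals contains exactly one of $p,\neg p$ per atom. A sequent is a finite set of formulas; $\Gamma,\varphi=\Gamma\cup\{\varphi\}$; $\Gamma$ is an axiom if $\Gamma\cap S\neq\emptyset$. Formula trees and depth. $T(\varphi)$ is the tree of nodes (finite sequences) of $\varphi$: the root $\langle\rangle$ carries $\varphi_{\langle\rangle}=\varphi$, and if $\varphi_\sigma=\bigvee_{i\in I}\psi_i$ or $\bigwedge_{i\in I}\psi_i$ then $\sigma i\in T(\varphi)$ with $\varphi_{\sigma i}=\psi_i$ for $i\in I$; literal nodes are leaves. $\bigvee$-nodes have positive, $\bigwedge$-nodes negative polarity, a non-root leaf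 has polarity opposite to its parent. $\mathrm{dt}(\langle\rangle)=0$, $\mathrm{dt}(\sigma i)=\mathrm{dt}(\sigma)$ if same polarity, $\mathrm{dt}(\sigma)+1$ otherwise. $\varphi$ has finite depth if these depths are bounded by some $\nu\in\mathbb{N}$. Games. $G=(X,E,A,W)$: moves $X$; $E,A\subseteq X^{<\mathbb{N}}\times X$ (Eloisa's, Abelard's legal moves) with disjoint domains; $W\subseteq P_G$, where $P_G$ is the set of finite sequences of successively legal moves. For $f\colon X^{<\mathbb{N}}\to X$, $T(f)$ is the set of plays $a_1\cdots a_n$ with, for each $i<n$, $a_1\cdots a_i\notin W$ and $a_{i+1}=f(a_1\cdots a_i)$ whenever $a_1\cdots a_i\in\mathrm{dom}(E)$. $f$ is a strategy for Eloisa if for all $p\in T(f)$: $p\in W$ implies no proper extension of $p$ lies in $T(f)$; $p\notin W$, $p\in\mathrm{dom}(E)$ implies exactly one $a$ with $pa\in T(f)$; $p\notin W$, $p\in\mathrm{dom}(A)$ implies $pa\in T(f)$ for all $(p,a)\in A$. A strategy $f$ is winning if for every infinite sequence $a_1a_2\cdots$ of moves there is $n$ with $a_1\cdots a_n\in P_G$ and either $a_1\cdots a_n\in W$, or $a_1\cdots a_n\in\mathrm{dom}(E)$ and $a_{n+1}\neq f(a_1\cdots a_n)$, or $a_1\cdots a_n\in\mathrm{dom}(A)$ and $(a_1\cdots a_n,a_{n+1})\notin A$. Tait game $G(\Gamma)$: moves $(\ell,\psi)$, $\ell\in\{g,q,r\}$ (guess, query, reply), $\psi$ a $\bigwedge$-formula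 if $\ell=q$; $\Gamma_n=\Gamma\cup\{\psi\mid(\ell,\psi)\in\{a_1,\dots,a_n\}\}$; Eloisa moves at $a_1\cdots a_n$ when $n=0$ or $a_n\neq(q,\cdot)$, playing $(g,\psi_j)$ for some $\bigvee_j\psi_j\in\Gamma_n$ or $(q,\psi)$ with $\psi\in\Gamma_n$; after $a_n=(q,\bigwedge_j\psi_j)$ Abelard plays $(r,\psi_j)$ for some $j$; $W$ is the set of plays $a_1\cdots a_n$ with $\Gamma_n$ an axiom. Interaction sequences. A pointer sequence is $i_0i_1\cdots$ with $i_0=0$, $i_{n+1}<n+1$; it is an interaction sequence if $i_{n+1}\in V(n+1)$, where $V(0)=\emptyset$, $V(n+1)=\{n\}\cup V(i_n)$. Debates. Let $\iota(n)$ be the parity of $n$ ($1$ if odd, $0$ if even), and let $X$ be the set of moves of $G(\Gamma)$. A quasi-debate $d$ assigns to every finite or infinite sequence $p=a_1a_2\cdots$ of elements of $X$ a finite or infinite sequence $(d_0,\dot p_0)(d_1,\dot p_1)\cdots$ where each $d_s$ has the form $(p_0,\sigma_0,i_0)\cdots(p_{n-1},\sigma_{n-1},i_{n-1})\,p_n$ ($p_n$ is the leading play of $d_s$) such that for all $m\le n$: (1) $p_m\in T(f_{\iota(m)})$; (2) $\sigma_m\in T(\varphi)$ for $m<n$; (3) $i_0\cdots i_{n-1}$ is an interaction sequence with $p_{i_m}$ a proper initial segment of $p_{m+1}$ and $\mathrm{dt}(\sigma_{i_m})<\mathrm{dt}(\sigma_m)$ for $0<m<n$; and for each $s$: (4)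 $\dot p_s$ is an initial segment of $p$ and a play in $G(\Gamma)$; (5) whenever $d_{s+1}$ is defined, $d_{s+1}\ne d_s$ extends $d_s$ (it begins with the triples $(p_0,\sigma_0,i_0)\cdots(p_{n-1},\sigma_{n-1},i_{n-1})$ of $d_s$, followed by a play extending $p_n$), and $\dot p_s\subseteq\dot p_{s+1}$. $d$ is monotone if $q\subseteq p$ implies $d(q)$ is an initial segment of $d(p)$. $d$ is non-losing if for every $s$ the following are equivalent: $d(p)$ is finite of length $s+1$; and, writing $\dot p_s=a_1\cdots a_l$ and $p_n$ the leading play of $d_s$, one of: (a) $\dot p_s\in W$; (b) $\dot p_s$ and $p_n$ are both in the domain of Eloisa's moves of their games, $a=f_{\iota(n)}(p_n)$ is a legal move in $G(\Gamma)$ at $\dot p_s$, and either $p=a_1\cdots a_l$ or $a_{l+1}$ exists and $a\neq a_{l+1}$; (c) $\dot p_s\in\mathrm{dom}(A)$ and either $p=a_1\cdots a_l$ or $a_{l+1}$ is not a legal move in $G(\Gamma)$. A debate (for $f_0,f_1,\Gamma,\varphi$) is a non-losing monotone quasi-debate; $d(p)$ is then a debate for $p$. *)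

(* Defs.v *)
From Stdlib Require Import List Arith Ensembles Finite_sets.
Import ListNotations.

Inductive word (A : Type) : Type :=
| Fin (l : list A)
| Inf (u : nat -> A).
Arguments Fin {A} l.
Arguments Inf {A} u.

Definition get {A : Type} (x : word A) (k : nat) : option A :=
  match x with
  | Fin l => nth_error l k
  | Inf u => Some (u k)
  end.

Definition has_length {A : Type} (x : word A) (n : nat) : Prop :=
  exists l : list A, x = Fin l /\ length l = n.

Definition initial {A : Type} (x y : word A) : Prop :=
  forall (k : nat) (a : A), get x k = Some a -> get y k = Some a.

Definition prefix {A : Type} (l m : list A) : Prop :=
  exists r : list A, m = l ++ r.

Definition proper_prefix {A : Type} (l m : list A) : Prop :=
  prefix l m /\ l <> m.

Definition take {A : Type} (u : nat -> A) (n : nat) : list A :=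
  map u (seq 0 n).

Inductive literal (Atom : Type) : Type :=
| pos (a : Atom)
| neg (a : Atom).
Arguments pos {Atom} a.
Arguments neg {Atom} a.

Definition neg_literal {Atom : Type} (l : literal Atom) : literal Atom :=
  match l with
  | pos a => neg a
  | neg a => pos a
  end.

Inductive formula (Atom : Type) : Type :=
| Lit (l : literal Atom)
| Or (J : Type) (ne : inhabited J) (psi : J -> formula Atom)
| And (J : Type) (ne : inhabited J) (psi : J -> formula Atom).
Arguments Lit {Atom} l.
Arguments Or {Atom} J ne psi.
Arguments And {Atom} J ne psi.

Fixpoint negation {Atom : Type} (phi : formula Atom) : formula Atom :=
  match phi with
  | Lit l => Lit (neg_literal l)
  | Or J ne psi => And J ne (fun i => negation (psi i))
  | And J ne psi => Or J ne (fun i => negation (psi i))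
  end.

Definition is_or {Atom : Type} (phi : formula Atom) : Prop :=
  match phi with Or _ _ _ => True | _ => False end.

Definition is_and {Atom : Type} (phi : formula Atom) : Prop :=
  match phi with And _ _ _ => True | _ => False end.

Definition exactly_one_per_atom {Atom : Type}
    (SL : Ensemble (literal Atom)) : Prop :=
  forall a : Atom,
    (SL (pos a) /\ ~ SL (neg a)) \/ (~ SL (pos a) /\ SL (neg a)).

Definition is_axiom {Atom : Type} (SL : Ensemble (literal Atom))
    (Gamma : Ensemble (formula Atom)) : Prop :=
  exists l : literal Atom, SL l /\ Gamma (Lit l).

(** [node phi psi] is the type of the nodes sigma of T(phi) with
    phi_sigma = psi; the constructors extend a node at its end. *)
Inductive node {Atom : Type} (phi : formula Atom) : formula Atom -> Type :=
| root : node phi phi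
| or_child (J : Type) (ne : inhabited J) (psi : J -> formula Atom)
    (sigma : node phi (Or J ne psi)) (i : J) : node phi (psi i)
| and_child (J : Type) (ne : inhabited J) (psi : J -> formula Atom)
    (sigma : node phi (And J ne psi)) (i : J) : node phi (psi i).
Arguments root {Atom phi}.
Arguments or_child {Atom phi J ne psi} sigma i.
Arguments and_child {Atom phi J ne psi} sigma i.

Definition tree {Atom : Type} (phi : formula Atom) : Type :=
  {psi : formula Atom & node phi psi}.

(** [true] is positive polarity; [leaf] is the polarity of a literal. *)
Definition polarity_with {Atom : Type} (leaf : bool) (psi : formula Atom)
    : bool :=
  match psi with
  | Lit _ => leaf
  | Or _ _ _ => true
  | And _ _ _ => false
  end.

(** A root that is a literal has no polarity; the value [true] given to it
    here is never used, since such a root has no children. *)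
Definition polarity {Atom : Type} {phi psi : formula Atom}
    (sigma : node phi psi) : bool :=
  match sigma with
  | root => polarity_with true phi
  | @or_child _ _ _ _ psi _ i => polarity_with false (psi i)
  | @and_child _ _ _ _ psi _ i => polarity_with true (psi i)
  end.

Fixpoint dt {Atom : Type} {phi psi : formula Atom} (sigma : node phi psi)
    : nat :=
  match sigma with
  | root => 0
  | or_child tau i =>
      if Bool.eqb (polarity (or_child tau i)) (polarity tau)
      then dt tau else dt tau + 1
  | and_child tau i =>
      if Bool.eqb (polarity (and_child tau i)) (polarity tau)
      then dt tau else dt tau + 1
  end.

Definition depth {Atom : Type} {phi : formula Atom} (sigma : tree phi) : nat :=
  dt (projT2 sigma).

Definition finite_depth {Atom : Type} (phi : formula Atom) : Prop :=
  exists nu : nat, forall sigma : tree phi, depth sigma <= nu.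

Definition dom {X : Type} (R : list X -> X -> Prop) (p : list X) : Prop :=
  exists a : X, R p a.

Inductive successively_legal {X : Type} (E A : list X -> X -> Prop)
    : list X -> Prop :=
| legal_nil : successively_legal E A []
| legal_snoc (p : list X) (a : X) :
    successively_legal E A p -> E p a \/ A p a ->
    successively_legal E A (p ++ [a]).

Record game (X : Type) : Type := Game {
  eloisa : list X -> X -> Prop;
  abelard : list X -> X -> Prop;
  won : list X -> Prop;
  dom_disjoint : forall p : list X, ~ (dom eloisa p /\ dom abelard p);
  won_play : forall p : list X, won p -> successively_legal eloisa abelard p
}.
Arguments Game {X} eloisa abelard won dom_disjoint won_play.
Arguments eloisa {X} g p a.
Arguments abelard {X} g p a.
Arguments won {X} g p.

Definition legal {X : Type} (G : game X) (p : list X) (a : X) : Prop :=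
  eloisa G p a \/ abelard G p a.

Definition play {X : Type} (G : game X) (p : list X) : Prop :=
  successively_legal (eloisa G) (abelard G) p.

(** The set T(f). *)
Definition consistent {X : Type} (G : game X) (f : list X -> X) (p : list X)
    : Prop :=
  play G p /\
  forall (q : list X) (a : X) (r : list X), p = q ++ a :: r ->
    ~ won G q /\ (dom (eloisa G) q -> a = f q).

Definition strategy {X : Type} (G : game X) (f : list X -> X) : Prop :=
  forall p : list X, consistent G f p ->
    (won G p -> forall q : list X, proper_prefix p q -> ~ consistent G f q) /\
    (~ won G p -> dom (eloisa G) p ->
       exists! a : X, consistent G f (p ++ [a])) /\
    (~ won G p -> dom (abelard G) p ->
       forall a : X, abelard G p a -> consistent G f (p ++ [a])).

(** The infinite sequence is indexed from 0, so that [a n] is the move that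
    follows [take a n]. *)
Definition winning_strategy {X : Type} (G : game X) (f : list X -> X) : Prop :=
  strategy G f /\
  forall a : nat -> X, exists n : nat,
    play G (take a n) /\
    (won G (take a n) \/
     (dom (eloisa G) (take a n) /\ a n <> f (take a n)) \/
     (dom (abelard G) (take a n) /\ ~ abelard G (take a n) (a n))).

Inductive move (Atom : Type) : Type :=
| guess (psi : formula Atom)
| query (psi : formula Atom) (conj : is_and psi)
| reply (psi : formula Atom).
Arguments guess {Atom} psi.
Arguments query {Atom} psi conj.
Arguments reply {Atom} psi.

Definition move_formula {Atom : Type} (a : move Atom) : formula Atom :=
  match a with
  | guess psi => psi
  | query psi _ => psi
  | reply psi => psi
  end.

(** The sequent Gamma_n at the position p = a_1 ... a_n. *)
Definition sequent_at {Atom : Type} (Gamma : Ensemble (formula Atom))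
    (p : list (move Atom)) : Ensemble (formula Atom) :=
  fun psi => Gamma psi \/ exists a : move Atom, List.In a p /\ move_formula a = psi.

Definition ends_with_query {Atom : Type} (p : list (move Atom))
    (psi : formula Atom) : Prop :=
  exists (q : list (move Atom)) (conj : is_and psi), p = q ++ [query psi conj].

Definition tait_eloisa {Atom : Type} (Gamma : Ensemble (formula Atom))
    (p : list (move Atom)) (a : move Atom) : Prop :=
  (forall psi : formula Atom, ~ ends_with_query p psi) /\
  match a with
  | guess chi =>
      exists (J : Type) (ne : inhabited J) (psi : J -> formula Atom) (j : J),
        sequent_at Gamma p (Or J ne psi) /\ chi = psi j
  | query psi _ => sequent_at Gamma p psi
  | reply _ => False
  end.

Definition tait_abelard {Atom : Type} (p : list (move Atom)) (a : move Atom)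
    : Prop :=
  exists (J : Type) (ne : inhabited J) (psi : J -> formula Atom) (j : J),
    ends_with_query p (And J ne psi) /\ a = reply (psi j).

Definition tait_won {Atom : Type} (SL : Ensemble (literal Atom))
    (Gamma : Ensemble (formula Atom)) (p : list (move Atom)) : Prop :=
  successively_legal (tait_eloisa Gamma) tait_abelard p /\
  is_axiom SL (sequent_at Gamma p).

Lemma tait_dom_disjoint {Atom : Type} (Gamma : Ensemble (formula Atom))
    (p : list (move Atom)) :
  ~ (dom (tait_eloisa Gamma) p /\ dom tait_abelard p).
Proof.
  intros [[a [Ha _]] [b [J [ne [psi [j [Hb _]]]]]]].
  exact (Ha _ Hb).
Qed.

Lemma tait_won_play {Atom : Type} (SL : Ensemble (literal Atom))
    (Gamma : Ensemble (formula Atom)) (p : list (move Atom)) :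
  tait_won SL Gamma p -> successively_legal (tait_eloisa Gamma) tait_abelard p.
Proof. intros [H _]; exact H. Qed.

Definition tait_game {Atom : Type} (SL : Ensemble (literal Atom))
    (Gamma : Ensemble (formula Atom)) : game (move Atom) :=
  Game (tait_eloisa Gamma) tait_abelard (tait_won SL Gamma)
    (tait_dom_disjoint Gamma) (tait_won_play SL Gamma).

Definition pointer_sequence (i : word nat) : Prop :=
  (forall k : nat, get i 0 = Some k -> k = 0) /\
  (forall n k : nat, get i (S n) = Some k -> k < S n).

(** [view i n k] means that k belongs to V(n), where V(0) is empty and
    V(n+1) = {n} U V(i_n); on a pointer sequence i_n < n+1, so that this
    recursion has a single solution. *)
Inductive view (i : word nat) : nat -> nat -> Prop :=
| view_last (n : nat) : view i (S n) n
| view_pointer (n j k : nat) :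
    get i n = Some j -> view i j k -> view i (S n) k.

Definition interaction_sequence (i : word nat) : Prop :=
  pointer_sequence i /\
  forall n k : nat, get i (S n) = Some k -> view i (S n) k.

(** A triple (p_m, sigma_m, i_m); that sigma_m belongs to T(phi) is part of
    the type. *)
Record triple {Atom : Type} (phi : formula Atom) : Type := Triple {
  triple_play : list (move Atom);
  triple_node : tree phi;
  triple_pointer : nat
}.
Arguments triple_play {Atom phi} t.
Arguments triple_node {Atom phi} t.
Arguments triple_pointer {Atom phi} t.

(** A sequence (p_0, sigma_0, i_0) ... (p_{n-1}, sigma_{n-1}, i_{n-1}) p_n. *)
Record stage {Atom : Type} (phi : formula Atom) : Type := Stage {
  triples : list (triple phi);
  leading : list (move Atom)
}.
Arguments triples {Atom phi} s.
Arguments leading {Atom phi} s.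

(** The plays p_0, ..., p_n. *)
Definition plays {Atom : Type} {phi : formula Atom} (e : stage phi)
    : list (list (move Atom)) :=
  map triple_play (triples e) ++ [leading e].

Definition pointers {Atom : Type} {phi : formula Atom} (e : stage phi)
    : list nat :=
  map triple_pointer (triples e).

Definition stage_extends {Atom : Type} {phi : formula Atom} (e e' : stage phi)
    : Prop :=
  prefix (triples e) (triples e') /\
  exists q : list (move Atom),
    nth_error (plays e') (length (triples e)) = Some q /\ prefix (leading e) q.

(** The game and the strategy on the side with parity [b]. *)
Definition side_game {Atom : Type} (SL : Ensemble (literal Atom))
    (Gamma : Ensemble (formula Atom)) (phi : formula Atom) (b : bool)
    : game (move Atom) :=
  tait_game SL
    (Add (formula Atom) Gamma (if b then phi else negation phi)).

Definition side_strategy {Atom : Type}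
    (f0 f1 : list (move Atom) -> move Atom) (b : bool)
    : list (move Atom) -> move Atom :=
  if b then f1 else f0.

Definition valid_stage {Atom : Type} (SL : Ensemble (literal Atom))
    (Gamma : Ensemble (formula Atom)) (phi : formula Atom)
    (f0 f1 : list (move Atom) -> move Atom) (e : stage phi) : Prop :=
  (forall (m : nat) (q : list (move Atom)), nth_error (plays e) m = Some q ->
     consistent (side_game SL Gamma phi (Nat.odd m))
       (side_strategy f0 f1 (Nat.odd m)) q) /\
  interaction_sequence (Fin (pointers e)) /\
  (forall (m : nat) (t t' : triple phi) (q : list (move Atom)),
     0 < m ->
     nth_error (triples e) m = Some t ->
     nth_error (triples e) (triple_pointer t) = Some t' ->
     nth_error (plays e) (S m) = Some q ->
     proper_prefix (triple_play t') q /\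
     depth (triple_node t') < depth (triple_node t)).

Definition quasi_debate {Atom : Type} (SL : Ensemble (literal Atom))
    (Gamma : Ensemble (formula Atom)) (phi : formula Atom)
    (f0 f1 : list (move Atom) -> move Atom)
    (d : word (move Atom) -> word (stage phi * list (move Atom))) : Prop :=
  forall (p : word (move Atom)) (s : nat) (e : stage phi)
    (pd : list (move Atom)),
    get (d p) s = Some (e, pd) ->
    valid_stage SL Gamma phi f0 f1 e /\
    initial (Fin pd) p /\
    play (tait_game SL Gamma) pd /\
    (forall (e' : stage phi) (pd' : list (move Atom)),
       get (d p) (S s) = Some (e', pd') ->
       e' <> e /\ stage_extends e e' /\ prefix pd pd').

Definition monotone {A B : Type} (d : word A -> word B) : Prop :=
  forall q p : word A, initial q p -> initial (d q) (d p).

Definition non_losing {Atom : Type} (SL : Ensemble (literal Atom))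
    (Gamma : Ensemble (formula Atom)) (phi : formula Atom)
    (f0 f1 : list (move Atom) -> move Atom)
    (d : word (move Atom) -> word (stage phi * list (move Atom))) : Prop :=
  forall (p : word (move Atom)) (s : nat) (e : stage phi)
    (pd : list (move Atom)),
    get (d p) s = Some (e, pd) ->
    let G := tait_game SL Gamma in
    let b := Nat.odd (length (triples e)) in
    let a := side_strategy f0 f1 b (leading e) in
    has_length (d p) (S s) <->
    (won G pd \/
     (dom (eloisa G) pd /\
      dom (eloisa (side_game SL Gamma phi b)) (leading e) /\
      legal G pd a /\
      (p = Fin pd \/
       exists c : move Atom, get p (length pd) = Some c /\ a <> c)) \/
     (dom (abelard G) pd /\
      (p = Fin pd \/
       exists c : move Atom, get p (length pd) = Some c /\ ~ legal G pd c))).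

Definition debate {Atom : Type} (SL : Ensemble (literal Atom))
    (Gamma : Ensemble (formula Atom)) (phi : formula Atom)
    (f0 f1 : list (move Atom) -> move Atom)
    (d : word (move Atom) -> word (stage phi * list (move Atom))) : Prop :=
  quasi_debate SL Gamma phi f0 f1 d /\
  monotone d /\
  non_losing SL Gamma phi f0 f1 d.

(* Main.v *)
Require Import Defs.
From Stdlib Require Import List Ensembles Finite_sets.
From Stdlib Require Import Arith Lia Wf_nat Classical ClassicalEpsilon.
Import ListNotations.

(** An infinite d(p) either extends one leading play forever, which a winning
    strategy forbids, or produces an infinite interaction sequence i with
    p_(i m) properly contained in p_(m+1) and with depths that increase
    strictly from i_m to m and are bounded.  The latter is refuted by induction
    on the bound D.  A position m of maximal depth is never pointed at, so what
    is visible after m is visible at i_m: deleting the block from i_m to m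
    leaves an interaction sequence.  Since p_(m+1) extends p_(i m), only
    finitely many such blocks can follow one another without a gap, so the
    deletion leaves an infinite sequence, whose depths are less than D. *)

(** * Well-foundedness and prefixes *)

Lemma no_chain_well_founded (X : Type) (R : X -> X -> Prop) :
  (forall c : nat -> X, ~ forall n, R (c (S n)) (c n)) -> well_founded R.
Proof.
  intros H x. apply NNPP. intro Hx.
  (* A non-accessible point has a non-accessible R-predecessor; iterating a choice of one yields the
     forbidden chain. *)
  assert (step : forall y : {y | ~ Acc R y},
             exists z : {z | ~ Acc R z}, R (proj1_sig z) (proj1_sig y)).
  { intros [y Hy]. apply NNPP. intro N. apply Hy. constructor. intros z Hz.
    apply NNPP. intro Nz. apply N. exists (exist _ z Nz). exact Hz. }
  set (next := fun y => proj1_sig (constructive_indefinite_description _ (step y))).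
  apply (H (fun n => proj1_sig (Nat.iter n next (exist _ x Hx)))).
  intro n. simpl.
  exact (proj2_sig (constructive_indefinite_description _ (step _))).
Qed.

Lemma nth_error_prefix (A : Type) (l m : list A) (n : nat) (a : A) :
  prefix l m -> nth_error l n = Some a -> nth_error m n = Some a.
Proof.
  intros [r ->] H. rewrite nth_error_app1; [exact H|].
  apply nth_error_Some. congruence.
Qed.

Lemma proper_prefix_length (A : Type) (l m : list A) :
  proper_prefix l m -> length l < length m.
Proof.
  intros [[[|x r] ->] N].
  - rewrite app_nil_r in N. congruence.
  - rewrite length_app. simpl. lia.
Qed.

Lemma proper_prefix_trans (A : Type) (l m n : list A) :
  proper_prefix l m -> proper_prefix m n -> proper_prefix l n.
Proof.
  intros H1 H2. pose proof (proper_prefix_length _ _ _ H1).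
  pose proof (proper_prefix_length _ _ _ H2).
  destruct H1 as [[r ->] _]. destruct H2 as [[r' ->] _].
  split.
  - exists (r ++ r'). symmetry. apply app_assoc.
  - intro E. rewrite <- E in *. lia.
Qed.

(** * Plays consistent with a winning strategy *)

Lemma take_S (A : Type) (u : nat -> A) (n : nat) :
  take u (S n) = take u n ++ [u n].
Proof. unfold take. rewrite seq_S, map_app. reflexivity. Qed.

Lemma play_app_inv (X : Type) (G : game X) (q r : list X) :
  play G (q ++ r) -> play G q.
Proof.
  induction r as [|a r IH] using rev_ind.
  - rewrite app_nil_r. trivial.
  - rewrite app_assoc. intro H. apply IH. inversion H as [E|p b Hp Hl E].
    + destruct (app_cons_not_nil _ _ _ E).
    + apply app_inj_tail in E. destruct E as [<- _]. exact Hp.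
Qed.

Lemma play_snoc_legal (X : Type) (G : game X) (q : list X) (a : X) :
  play G (q ++ [a]) -> legal G q a.
Proof.
  intro H. inversion H as [E|p b Hp Hl E].
  - destruct (app_cons_not_nil _ _ _ E).
  - apply app_inj_tail in E. destruct E as [<- <-]. exact Hl.
Qed.

Lemma consistent_app_inv (X : Type) (G : game X) (f : list X -> X)
    (q r : list X) :
  consistent G f (q ++ r) -> consistent G f q.
Proof.
  intros [Hp H]. split; [exact (play_app_inv _ _ _ _ Hp)|].
  intros q' a r' ->. apply (H q' a (r' ++ r)).
  rewrite <- app_assoc. reflexivity.
Qed.

Lemma winning_no_infinite_play (X : Type) (G : game X) (f : list X -> X)
    (a : nat -> X) :
  winning_strategy G f -> ~ forall n, consistent G f (take a n).
Proof.
  intros [_ W] H. destruct (W a) as [n [_ Hn]].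
  destruct (H (S n)) as [Hp Hc]. rewrite take_S in *.
  destruct (Hc _ _ _ eq_refl) as [Hw Hf].
  destruct Hn as [Hn|[[Hd Hn]|[Hd Hn]]]; [tauto|tauto|].
  (* The last move is legal but not Abelard's, so it is a move of Eloisa's in Abelard's domain,
     against disjointness. *)
  apply play_snoc_legal in Hp. destruct Hp as [Hl|Hl]; [|tauto].
  apply (dom_disjoint _ G (take a n)). split; [exists (a n)|]; assumption.
Qed.

Definition consistent_extension {X : Type} (G : game X) (f : list X -> X)
    (q q' : list X) : Prop :=
  consistent G f q' /\ proper_prefix q q'.

(** An infinite chain of proper extensions converges to an infinite sequence of moves whose initial
    segments are all consistent. *)
Lemma winning_well_founded (X : Type) (G : game X) (f : list X -> X) :
  winning_strategy G f ->
  well_founded (fun q' q => consistent_extension G f q q').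
Proof.
  intro W. apply no_chain_well_founded. intros c Hc.
  assert (len : forall n, n <= length (c n)).
  { induction n; [lia|]. destruct (Hc n) as [_ P].
    apply proper_prefix_length in P. lia. }
  (* By [len], [c (S n)] is long enough to have a move at index n; [f []] is only the default value
     that [nth] asks for. *)
  set (a := fun n => nth n (c (S n)) (f [])).
  assert (pre : forall n, prefix (take a n) (c n)).
  { induction n as [|n [r Hr]]; [exists (c 0); reflexivity|].
    destruct (Hc n) as [_ [[r' Hr'] _]].
    rewrite Hr, <- app_assoc in Hr'. pose proof (len (S n)) as L.
    assert (T : length (take a n) = n)
      by (unfold take; rewrite length_map, length_seq; reflexivity).
    rewrite take_S. unfold a at 2. rewrite Hr' in *.
    rewrite length_app, T in L.
    destruct (r ++ r') as [|x t]; [simpl in L; lia|].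
    rewrite app_nth2, T, Nat.sub_diag by lia. exists t.
    rewrite <- app_assoc. reflexivity. }
  apply (winning_no_infinite_play _ G f a W). intro n.
  destruct (pre (S n)) as [r Hr]. destruct (Hc n) as [C _].
  rewrite Hr, take_S, <- app_assoc in C.
  exact (consistent_app_inv _ _ _ _ _ C).
Qed.

(** * Views and interaction sequences *)

(** The view V(n) of an infinite pointer sequence. *)
Inductive seen (i : nat -> nat) : nat -> nat -> Prop :=
| seen_last (n : nat) : seen i (S n) n
| seen_pointer (n k : nat) : seen i (i n) k -> seen i (S n) k.

Definition interaction (i : nat -> nat) : Prop :=
  i 0 = 0 /\ forall n, seen i (S n) (i (S n)).

Lemma seen_0 (i : nat -> nat) (k : nat) : ~ seen i 0 k.
Proof. intro H. inversion H. Qed.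

Lemma seen_S_inv (i : nat -> nat) (n k : nat) :
  seen i (S n) k -> k = n \/ seen i (i n) k.
Proof. intro H. inversion H; auto. Qed.

Lemma interaction_seen (i : nat -> nat) (n : nat) :
  interaction i -> 0 < n -> seen i n (i n).
Proof. intros [_ H] Hn. destruct n; [lia|]. apply H. Qed.

(** This recovers the bound on pointers from [interaction]: for positive n the pointer i(n) is
    itself visible at n, so the induction hypothesis bounds first i(n) and then its view. *)
Lemma seen_lt (i : nat -> nat) :
  interaction i -> forall n k, seen i n k -> k < n.
Proof.
  intros Hi. induction n as [n IH] using lt_wf_ind. intros k H.
  destruct n as [|n]; [destruct (seen_0 _ _ H)|].
  apply seen_S_inv in H as [->|H]; [lia|].
  destruct n as [|n].
  - destruct Hi as [H0 _]. rewrite H0 in H. destruct (seen_0 _ _ H).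
  - assert (i (S n) < S n) by (apply (IH (S n)); [lia|apply Hi]).
    apply IH in H; lia.
Qed.

Lemma pointer_lt (i : nat -> nat) (n : nat) :
  interaction i -> 0 < n -> i n < n.
Proof. intros Hi Hn. apply (seen_lt i Hi), interaction_seen; assumption. Qed.

Lemma odd_shift (m n : nat) :
  Nat.odd m = Nat.odd (S n) -> Nat.odd (S m) = Nat.odd n.
Proof.
  rewrite !Nat.odd_succ, <- !Nat.negb_odd. intros ->. apply Bool.negb_involutive.
Qed.

(** By induction i(n) has the parity of n+1 for positive n, so following a pointer down the view
    keeps the parity. This places p_(i m) and p_(m+1) in the same game. *)
Lemma seen_parity (i : nat -> nat) :
  interaction i -> forall n k, seen i n k -> Nat.odd n = Nat.odd (S k).
Proof.
  intros Hi. induction n as [n IH] using lt_wf_ind. intros k H.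
  destruct n as [|n]; [destruct (seen_0 _ _ H)|].
  apply seen_S_inv in H as [->|H]; [reflexivity|].
  destruct n as [|n].
  - destruct Hi as [H0 _]. rewrite H0 in H. destruct (seen_0 _ _ H).
  - pose proof (pointer_lt i (S n) Hi ltac:(lia)) as L.
    assert (P := IH (S n) ltac:(lia) _ (proj2 Hi n)).
    rewrite <- (IH (i (S n)) ltac:(lia) k H).
    apply odd_shift, P.
Qed.

Lemma pointer_parity (i : nat -> nat) (m : nat) :
  interaction i -> 0 < m -> Nat.odd (i m) = Nat.odd (S m).
Proof.
  intros Hi Hm. pose proof (seen_parity i Hi _ _ (interaction_seen i m Hi Hm)) as P.
  symmetry. apply odd_shift, P.
Qed.

(** * Skipping blocks of maximal depth *)

Definition block (i h : nat -> nat) (D m : nat) : Prop := 0 < m /\ h m = D.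

(** [settle i h D x y]: skipping the blocks that follow one another from
    position [x] on, one arrives at [y], where no block begins. *)
Inductive settle (i h : nat -> nat) (D : nat) : nat -> nat -> Prop :=
| settle_stay (x : nat) :
    (forall m, block i h D m -> i m <> x) -> settle i h D x x
| settle_skip (m y : nat) :
    block i h D m -> settle i h D (S m) y -> settle i h D (i m) y.

Section Deletion.

(** In the application [P m] is the play p_m tagged with the parity of m, [h m] is the depth of
    sigma_m, and R is proper extension to a consistent play of the same game. *)
Variables (X : Type) (R : X -> X -> Prop).
Hypothesis R_trans : forall x y z, R x y -> R y z -> R x z.
Hypothesis R_wf : well_founded (fun y x => R x y).

Variables (i h : nat -> nat) (P : nat -> X) (D : nat).
Hypothesis Hi : interaction i.
Hypothesis h_pointer : forall m, 0 < m -> h (i m) < h m.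
Hypothesis h_bound : forall m, h m <= D.
Hypothesis P_step : forall m, 0 < m -> R (P (i m)) (P (S m)).

(** Each skip leads from [P (i m)] to [P (S m)], an R-step, and R admits no infinite ascent. *)
Lemma settle_total (x : nat) : exists y, settle i h D x y.
Proof.
  remember (P x) as q eqn:E. revert x E.
  induction q as [q IH] using (well_founded_ind R_wf). intros x ->.
  destruct (classic (exists m, block i h D m /\ i m = x)) as [[m [B <-]]|N].
  - destruct (IH (P (S m)) (P_step m (proj1 B)) _ eq_refl) as [y Hy].
    exists y. apply settle_skip; assumption.
  - exists x. apply settle_stay. intros m B E. apply N. exists m. tauto.
Qed.

Lemma settle_no_block (x y m : nat) :
  settle i h D x y -> block i h D m -> i m <> y.
Proof. induction 1; auto. Qed.

Lemma settle_le (x y : nat) : settle i h D x y -> x <= y.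
Proof.
  induction 1 as [|m y B _ IH]; [lia|].
  pose proof (pointer_lt i m Hi (proj1 B)). lia.
Qed.

Lemma settle_play (x y : nat) :
  settle i h D x y -> P x = P y \/ R (P x) (P y).
Proof.
  induction 1 as [|m y B _ IH]; [tauto|]. right.
  pose proof (P_step m (proj1 B)) as S. destruct IH as [<-|IH]; eauto.
Qed.

(** The view of m+1 adds only m to that of i(m), and m has depth D, so it is not z. *)
Lemma settle_seen (x y z : nat) :
  settle i h D x y -> h z < D -> seen i y z -> seen i x z.
Proof.
  intros H Hz. induction H as [|m y B _ IH]; [trivial|].
  intro V. apply IH, seen_S_inv in V as [->|V]; [|exact V].
  destruct B. lia.
Qed.

Lemma pointer_below (m : nat) : 0 < m -> h (i m) < D.
Proof. intro Hm. pose proof (h_pointer m Hm). pose proof (h_bound m). lia. Qed.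

Lemma h_0_below : h 0 < D.
Proof.
  pose proof (pointer_lt i 1 Hi ltac:(lia)).
  replace 0 with (i 1) by lia. apply pointer_below. lia.
Qed.

(** A block starting at 0 would leave position [m + 1] nothing to point at. *)
Lemma block_pointer_pos (m : nat) : block i h D m -> i m <> 0.
Proof.
  intros [Hm HD] E. destruct (seen_S_inv _ _ _ (proj2 Hi m)) as [S|S].
  - pose proof (pointer_below (Datatypes.S m) ltac:(lia)) as B.
    rewrite S in B. lia.
  - rewrite E in S. exact (seen_0 _ _ S).
Qed.

(** * The positions that survive the deletion *)

Definition settled (x : nat) : nat := epsilon (inhabits 0) (settle i h D x).

Lemma settledP (x : nat) : settle i h D x (settled x).
Proof. exact (epsilon_spec (inhabits 0) _ (settle_total x)). Qed.

(** Increasing enumeration of the surviving positions. Several blocks may begin at one position, so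
    where the skipping ends is a choice, made by [settled]. *)
Fixpoint kept (n : nat) : nat :=
  match n with 0 => 0 | S n => settled (S (kept n)) end.

Lemma kept_lt_succ (n : nat) : kept n < kept (S n).
Proof. exact (settle_le _ _ (settledP (S (kept n)))). Qed.

Lemma kept_lt (m n : nat) : m < n -> kept m < kept n.
Proof.
  induction 1 as [|n _ IH]; [apply kept_lt_succ|].
  pose proof (kept_lt_succ n). lia.
Qed.

Lemma kept_lt_inv (m n : nat) : kept m < kept n -> m < n.
Proof.
  intro H. destruct (Nat.lt_trichotomy m n) as [L|[->|L]]; [exact L|lia|].
  pose proof (kept_lt _ _ L). lia.
Qed.

Lemma kept_inj (m n : nat) : kept m = kept n -> m = n.
Proof.
  intro H. destruct (Nat.lt_trichotomy m n) as [L|[E|L]]; [|exact E|];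
    pose proof (kept_lt _ _ L); lia.
Qed.

Lemma kept_no_block (n m : nat) : block i h D m -> i m <> kept n.
Proof.
  destruct n as [|n]; [apply block_pointer_pos|].
  apply settle_no_block with (1 := settledP (S (kept n))).
Qed.

(** The pointer of [kept n], renumbered along [kept]. For positive n, [seen_kept] shows that its
    target is kept, so that the choice is meaningful. *)
Definition kept_pointer (n : nat) : nat :=
  epsilon (inhabits 0) (fun j => kept j = i (kept n)).

Lemma kept_pointerP (n j : nat) :
  i (kept n) = kept j -> kept_pointer n = j.
Proof.
  intro H. apply kept_inj. rewrite <- H.
  apply (epsilon_spec (inhabits 0) (fun j => kept j = i (kept n))).
  exists j. congruence.
Qed.

Lemma kept_pos (n : nat) : 0 < n -> 0 < kept n.
Proof. intro H. pose proof (kept_lt _ _ H). lia. Qed.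

Lemma kept_pointer_0 : kept_pointer 0 = 0.
Proof. apply kept_pointerP. simpl. apply Hi. Qed.

(** Once the skips are undone by [settle_seen], z is either the preceding kept position or visible
    at the target of its pointer, where the induction continues. *)
Lemma seen_kept (n : nat) :
  forall z, h z < D -> seen i (kept n) z ->
  exists j, z = kept j /\ seen kept_pointer n j.
Proof.
  induction n as [n IH] using lt_wf_ind. intros z Hz V.
  destruct n as [|n]; [destruct (seen_0 _ _ V)|].
  apply (settle_seen _ _ _ (settledP (S (kept n))) Hz) in V.
  apply seen_S_inv in V as [->|V].
  - exists n. split; [reflexivity|apply seen_last].
  - destruct n as [|n].
    + simpl in V. rewrite (proj1 Hi) in V. destruct (seen_0 _ _ V).
    + pose proof (kept_pos (S n) ltac:(lia)) as L.
      (* The target of the pointer is visible and of depth below D, so the induction hypothesis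
         makes it some [kept j]; a second use, at j, treats z. *)
      destruct (IH (S n) ltac:(lia) (i (kept (S n))) (pointer_below _ L)
                  (interaction_seen i _ Hi L)) as [j [E _]].
      assert (j < S n).
      { apply kept_lt_inv. rewrite <- E. apply pointer_lt; assumption. }
      rewrite E in V. destruct (IH j ltac:(lia) z Hz V) as [k [Ek Vk]].
      exists k. split; [exact Ek|]. apply seen_pointer.
      rewrite (kept_pointerP _ _ E). exact Vk.
Qed.

Lemma kept_pointer_spec (n : nat) :
  0 < n ->
  i (kept n) = kept (kept_pointer n) /\ seen kept_pointer n (kept_pointer n).
Proof.
  intro Hn. pose proof (kept_pos n Hn) as L.
  destruct (seen_kept n _ (pointer_below _ L) (interaction_seen i _ Hi L))
    as [j [E V]].
  rewrite (kept_pointerP _ _ E). auto.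
Qed.

Lemma kept_interaction : interaction kept_pointer.
Proof.
  split; [apply kept_pointer_0|].
  intro n. apply kept_pointer_spec. lia.
Qed.

(** A block ends at no kept position, since by [seen_kept] its first position
    would be kept as well, and no block begins at a kept position. *)
Lemma kept_below (n : nat) : h (kept n) < D.
Proof.
  destruct n as [|n]; [apply h_0_below|].
  pose proof (kept_pos (S n) ltac:(lia)) as L.
  destruct (kept_pointer_spec (S n) ltac:(lia)) as [E _].
  pose proof (kept_no_block (kept_pointer (S n)) (kept (S n))) as N.
  pose proof (h_bound (kept (S n))).
  destruct (Nat.eq_dec (h (kept (S n))) D); [|lia].
  destruct N; [split; assumption|exact E].
Qed.

(** The pointer of [kept m] gives an R-step to the play just after [kept m]; skipping on to
    [kept (S m)] only climbs further along R. *)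
Lemma kept_play (m : nat) :
  0 < m -> R (P (kept (kept_pointer m))) (P (kept (S m))).
Proof.
  intro Hm. rewrite <- (proj1 (kept_pointer_spec m Hm)).
  pose proof (P_step (kept m) (kept_pos m Hm)) as S.
  destruct (settle_play _ _ (settledP (Datatypes.S (kept m)))) as [E|E].
  - simpl. rewrite <- E. exact S.
  - exact (R_trans _ _ _ S E).
Qed.

End Deletion.

(** The kept positions give new i, h and P with a smaller bound, hence the quantification over these
    three. For D = 0, position 1 cannot lie deeper than its target. *)
Lemma no_infinite_bounded_interaction (X : Type) (R : X -> X -> Prop)
    (R_trans : forall x y z, R x y -> R y z -> R x z)
    (R_wf : well_founded (fun y x => R x y)) (D : nat) :
  forall (i h : nat -> nat) (P : nat -> X),
  interaction i ->
  (forall m, 0 < m -> h (i m) < h m) ->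
  (forall m, h m <= D) ->
  (forall m, 0 < m -> R (P (i m)) (P (S m))) ->
  False.
Proof.
  induction D as [|D IH]; intros i h P Hi Hh Hb HP.
  - pose proof (Hh 1 ltac:(lia)). pose proof (Hb 1). lia.
  - pose (e := kept i h (S D)).
    apply (IH (kept_pointer i h (S D)) (fun n => h (e n)) (fun n => P (e n))).
    + eapply kept_interaction; eassumption.
    + intros m Hm. unfold e.
      rewrite <- (proj1 (kept_pointer_spec _ _ R_wf _ _ _ _ Hi Hh Hb HP m Hm)).
      apply Hh. eapply kept_pos; eassumption.
    + intro m. apply Nat.lt_succ_r.
      eapply kept_below; eassumption.
    + intros m Hm. eapply kept_play; eassumption.
Qed.

(** * Stages of a debate *)

Lemma stage_extends_length (Atom : Type) (phi : formula Atom)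
    (e e' : stage phi) :
  stage_extends e e' -> length (triples e) <= length (triples e').
Proof. intros [[r ->] _]. rewrite length_app. lia. Qed.

(** Equally many triples means equal triples, so the two stages can differ only in the leading
    play. *)
Lemma stage_extends_leading (Atom : Type) (phi : formula Atom)
    (e e' : stage phi) :
  stage_extends e e' -> e' <> e -> length (triples e') = length (triples e) ->
  proper_prefix (leading e) (leading e').
Proof.
  destruct e as [t l], e' as [t' l']. unfold stage_extends, plays. simpl.
  intros [[r Hr] [q [Hq Hl]]] N L.
  assert (r = []) as ->.
  { apply length_zero_iff_nil. rewrite Hr, length_app in L. lia. }
  rewrite app_nil_r in Hr. subst t'.
  rewrite nth_error_app2, length_map, Nat.sub_diag in Hq
    by (rewrite length_map; lia).
  injection Hq as <-. split; [exact Hl|]. congruence.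
Qed.

Lemma nth_error_plays (Atom : Type) (phi : formula Atom) (e : stage phi)
    (n : nat) (t : triple phi) :
  nth_error (triples e) n = Some t ->
  nth_error (plays e) n = Some (triple_play t).
Proof.
  intro H. unfold plays. rewrite nth_error_app1.
  - rewrite nth_error_map, H. reflexivity.
  - rewrite length_map. apply nth_error_Some. congruence.
Qed.

Lemma nth_error_leading (Atom : Type) (phi : formula Atom) (e : stage phi) :
  nth_error (plays e) (length (triples e)) = Some (leading e).
Proof.
  unfold plays. rewrite nth_error_app2; rewrite length_map; [|lia].
  rewrite Nat.sub_diag. reflexivity.
Qed.

(** * The limit of an infinite debate *)

Section Debate.

Variables (Atom : Type) (SL : Ensemble (literal Atom))
  (Gamma : Ensemble (formula Atom)) (phi : formula Atom)
  (f0 f1 : list (move Atom) -> move Atom).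
Hypothesis hdepth : finite_depth phi.
Hypothesis hwin : forall b,
  winning_strategy (side_game SL Gamma phi b) (side_strategy f0 f1 b).

Variable E : nat -> stage phi.
Hypothesis E_valid : forall s, valid_stage SL Gamma phi f0 f1 (E s).
Hypothesis E_neq : forall s, E (S s) <> E s.
Hypothesis E_ext : forall s, stage_extends (E s) (E (S s)).

Lemma leading_consistent (s : nat) (b : bool) :
  Nat.odd (length (triples (E s))) = b ->
  consistent (side_game SL Gamma phi b) (side_strategy f0 f1 b) (leading (E s)).
Proof.
  intros <-. destruct (E_valid s) as [H _]. apply H, nth_error_leading.
Qed.

Lemma E_triples_prefix (s s' : nat) :
  s <= s' -> prefix (triples (E s)) (triples (E s')).
Proof.
  induction 1 as [|s' _ [r Hr]].
  - exists []. symmetry. apply app_nil_r.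
  - destruct (E_ext s') as [[r' ->] _]. rewrite Hr.
    exists (r ++ r'). symmetry. apply app_assoc.
Qed.

(** Otherwise the leading play would grow forever in one game, the one fixed by the parity of the
    number of triples. *)
Lemma triples_grow (s : nat) :
  exists s', length (triples (E s)) < length (triples (E s')).
Proof.
  apply NNPP. intro N.
  assert (L : forall k, length (triples (E (k + s))) = length (triples (E s))).
  { induction k as [|k IH]; [reflexivity|].
    pose proof (stage_extends_length _ _ _ _ (E_ext (k + s))).
    destruct (Nat.eq_dec (length (triples (E (S k + s)))) (length (triples (E s))));
      [assumption|].
    destruct N. exists (S k + s). simpl in *. lia. }
  set (b := Nat.odd (length (triples (E s)))).
  (* Induction on accessibility: from stage s on, each leading play is properly extended by the
     next. *)
  assert (A : forall q, Acc (fun q' q => consistent_extension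
      (side_game SL Gamma phi b) (side_strategy f0 f1 b) q q') q ->
    forall k, leading (E (k + s)) <> q).
  { induction 1 as [q _ IH]. intros k <-.
    apply (IH (leading (E (S k + s)))) with (S k); [|reflexivity]. split.
    - apply leading_consistent. rewrite L. reflexivity.
    - apply stage_extends_leading; [apply E_ext|apply E_neq|].
      rewrite (L k). apply (L (S k)). }
  apply (A _ (winning_well_founded _ _ _ (hwin b) (leading (E (0 + s)))) 0).
  reflexivity.
Qed.

Lemma triples_unbounded (n : nat) : exists s, n <= length (triples (E s)).
Proof.
  induction n as [|n [s Hs]]; [exists 0; lia|].
  destruct (triples_grow s) as [s' Hs']. exists s'. lia.
Qed.

(** Of any two stages one has its triples as a prefix of the other's, so all stages long enough
    agree at n. *)
Lemma limit_triples :
  exists t : nat -> triple phi, forall s n, n < length (triples (E s)) ->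
    nth_error (triples (E s)) n = Some (t n).
Proof.
  assert (H : forall n, exists t, forall s, n < length (triples (E s)) ->
             nth_error (triples (E s)) n = Some t).
  { intro n. destruct (triples_unbounded (S n)) as [s Hs].
    destruct (nth_error (triples (E s)) n) as [t|] eqn:Et.
    2:{ apply nth_error_None in Et. lia. }
    exists t. intros s' Hs'. destruct (Nat.le_ge_cases s s') as [L|L].
    - exact (nth_error_prefix _ _ _ _ _ (E_triples_prefix _ _ L) Et).
    - destruct (nth_error (triples (E s')) n) as [t'|] eqn:Et'.
      + rewrite <- Et. symmetry.
        exact (nth_error_prefix _ _ _ _ _ (E_triples_prefix _ _ L) Et').
      + apply nth_error_None in Et'. lia. }
  exists (fun n => proj1_sig (constructive_indefinite_description _ (H n))).
  intros s n. exact (proj2_sig (constructive_indefinite_description _ (H n)) s).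
Qed.

Lemma no_infinite_debate : False.
Proof.
  destruct limit_triples as [t Ht].
  set (i := fun n => triple_pointer (t n)).
  assert (ptr : forall s n, n < length (triples (E s)) ->
             get (Fin (pointers (E s))) n = Some (i n)).
  { intros s n L. simpl. unfold pointers.
    rewrite nth_error_map, (Ht s n L). reflexivity. }
  assert (Hi : interaction i).
  { split.
    - destruct (triples_unbounded 1) as [s Hs].
      destruct (E_valid s) as [_ [[[H0 _] _] _]]. apply H0, ptr. lia.
    - intro n. destruct (triples_unbounded (S (S n))) as [s Hs].
      destruct (E_valid s) as [_ [[_ H] _]].
      specialize (H n _ (ptr s (S n) ltac:(lia))).
      (* The view is taken on the finite pointer list of [E s], which agrees with i wherever it is
         defined. *)
      revert H. generalize (i (S n)) as k. generalize (S n) as m.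
      induction 1 as [m|m j k Hj _ IH]; [apply seen_last|].
      apply seen_pointer. enough (i m = j) as -> by exact IH.
      assert (L : m < length (triples (E s))).
      { rewrite <- (length_map triple_pointer). apply nth_error_Some.
        simpl in Hj. unfold pointers in Hj. congruence. }
      rewrite (ptr s m L) in Hj. congruence. }
  destruct hdepth as [nu Hnu].
  (* The parity tag lets a single relation serve both games. *)
  set (R := fun x y : bool * list (move Atom) => fst x = fst y /\
    consistent_extension (side_game SL Gamma phi (fst x))
      (side_strategy f0 f1 (fst x)) (snd x) (snd y)).
  assert (R_trans : forall x y z, R x y -> R y z -> R x z).
  { intros [a x] [b y] [c z]. unfold R, consistent_extension. simpl.
    intros [<- [_ H]] [<- [H1 H2]].
    split; [reflexivity|]. split; [exact H1|].
    exact (proper_prefix_trans _ _ _ _ H H2). }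
  assert (R_wf : well_founded (fun y x => R x y)).
  { intros [b q].
    induction q as [q IH] using (well_founded_ind (winning_well_founded _ _ _ (hwin b))).
    constructor. intros [c q'] [Ec Hq]. simpl in Ec, Hq. subst c. auto. }
  assert (step : forall m, 0 < m ->
    consistent_extension (side_game SL Gamma phi (Nat.odd (S m)))
      (side_strategy f0 f1 (Nat.odd (S m)))
      (triple_play (t (i m))) (triple_play (t (S m))) /\
    depth (triple_node (t (i m))) < depth (triple_node (t m))).
  (* With at least m+2 triples, p_(m+1) is the play of a triple and not the leading play. *)
  { intros m Hm. destruct (triples_unbounded (S (S m))) as [s Hs].
    pose proof (pointer_lt i m Hi Hm) as L.
    destruct (E_valid s) as [C [_ H]].
    pose proof (nth_error_plays _ _ _ _ _ (Ht s (S m) ltac:(lia))) as Pm.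
    destruct (H m (t m) (t (i m)) _ Hm (Ht s m ltac:(lia))
                (Ht s (i m) ltac:(lia)) Pm) as [HP Hd].
    split; [|exact Hd]. split; [|exact HP]. apply C. exact Pm. }
  apply (no_infinite_bounded_interaction _ R R_trans R_wf nu i
    (fun n => depth (triple_node (t n)))
    (fun n => (Nat.odd n, triple_play (t n))) Hi).
  - apply step.
  - intro m. apply Hnu.
  - intros m Hm. unfold R. simpl fst. simpl snd.
    rewrite (pointer_parity i m Hi Hm). split; [reflexivity|]. apply step, Hm.
Qed.

End Debate.

Theorem mainTheorem14 (Atom : Type) (SL : Ensemble (literal Atom))
    (hSL : exactly_one_per_atom SL)
    (Gamma : Ensemble (formula Atom)) (hGamma : Finite (formula Atom) Gamma)
    (phi : formula Atom) (hor : is_or phi) (hdepth : finite_depth phi)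
    (f0 f1 : list (move Atom) -> move Atom)
    (hf0 : winning_strategy
             (tait_game SL (Add (formula Atom) Gamma (negation phi))) f0)
    (hf1 : winning_strategy
             (tait_game SL (Add (formula Atom) Gamma phi)) f1)
    (d : word (move Atom) -> word (stage phi * list (move Atom)))
    (hd : debate SL Gamma phi f0 f1 d)
    (p : word (move Atom)) :
  exists s : nat, get (d p) s = None.
Proof.
  destruct hd as [hq _]. specialize (hq p).
  destruct (d p) as [l|u].
  - exists (length l). apply nth_error_None. lia.
  - exfalso.
    assert (step : forall s, valid_stage SL Gamma phi f0 f1 (fst (u s)) /\
        fst (u (S s)) <> fst (u s) /\
        stage_extends (fst (u s)) (fst (u (S s)))).
    { intro s. destruct (u s) as [e pd] eqn:Es.
      destruct (u (S s)) as [e' pd'] eqn:Es'.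
      destruct (hq s e pd (f_equal Some Es)) as [V [_ [_ H]]].
      destruct (H e' pd' (f_equal Some Es')) as [N [X _]]. auto. }
    apply (no_infinite_debate Atom SL Gamma phi f0 f1 hdepth)
      with (E := fun s => fst (u s)).
    (* The boolean is a parity: [true] selects the game of [f1], [false] that of [f0]. *)
    1: intros [|]; assumption.
    all: intro s; apply step.
Qed.
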